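(* Let $F\subset\mathbb{R}^n$ be a fractal curve, let $q,r$ be $F$-continuous functions defined on $F$, and let $\beta\in\mathbb{R}$. Consider the fractal Bernoulli differential equation $$D_F^{\alpha}y(\theta)+q(\theta)\,y(\theta)=r(\theta)\,y(\theta)^{\beta},\qquad\theta\in F .$$ (i) If $\beta=0$, then $y^{\beta}(\theta)=1$ and the equation is the $\alpha$-order linear equation $D_F^{\alpha}y(\theta)+q(\theta)y(\theta)=r(\theta)$. If $\beta=1$, the equation is the $\alpha$-order linear equation $D_F^{\alpha}y(\theta)+p(\theta)y(\theta)=0$ with $p(\theta)=q(\theta)-r(\theta)$. (ii) If $\beta>0$, then $y(\theta)=0$ is a solution of the equation. (iii) In all other cases ($\beta\neq0$ and $\beta\neq1$), dividing both sides by $y^{\beta}(\theta)$ and setting $z(\theta)=y^{1-\beta}(\theta)$, so that $D_F^{\alpha}z(\theta)=(1-\beta)\,y^{-\beta}(\theta)\,D_F^{\alpha}y(\theta)$, transforms the equation into the linear equation $$D_F^{\alpha}z(\theta)+(1-\beta)\,q(\theta)\,z(\theta)=(1-\beta)\,r(\theta).$$ Applying the integrating factor method to it and setting $y(\theta)=(z(\theta))^{\frac{1}{1-\beta}}$, the solution of the fractal Bernoulli differential equation is $$y(\theta)=\left(\frac{\displaystyle\int r(\theta)\,\mu(\theta)\,d_F^{\alpha}\theta+c}{\mu(\theta)}\right)^{\frac{1}{1-\beta}},$$ where $\Lambda(\theta)$ is a primitive of $q(\theta)$, $\mu(\theta)=e^{\Lambda(\theta)}$, and $c$ is a constant of inte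gration.
   Context: Fractal curve: a set $F\subset\mathbb{R}^n$ with a continuous bijective parametrization $\mathbf{w}:[a_0,b_0]\to F$. Mass function: let $1\le\alpha\le n$. For $[a,b]\subset[a_0,b_0]$, $$\gamma^{\alpha}(F,a,b)=\lim_{\delta\to0}\ \inf_{|P|\le\delta}\ \sum_{i=0}^{m-1}\frac{|\mathbf{w}(t_{i+1})-\mathbf{w}(t_i)|^{\alpha}}{\Gamma(\alpha+1)},$$ the infimum being over subdivisions $P=\{a=t_0<\dots<t_m=b\}$ with $|P|=\max_i(t_{i+1}-t_i)\le\delta$, and $|\cdot|$ the Euclidean norm. Mass of the curve up to a point: fix an arbitrary $p_0\in[a_0,b_0]$; $S_F^{\alpha}(u)=\gamma^{\alpha}(F,p_0,u)$ if $u\ge p_0$ and $S_F^{\alpha}(u)=-\gamma^{\alpha}(F,u,p_0)$ if $u<p_0$. For $\theta=\mathbf{w}(u)\in F$ put $J(\theta)=S_F^{\alpha}(u)$. Fractal limit and $F$-continuity: $F\text{-}\lim_{\theta'\to\theta}f(\theta')=\ell$ means that for every $\varepsilon>0$ there is $\delta>0$ such that $|f(\theta')-\ell|<\varepsilon$ for all $\theta'\in F$ with $0<|\theta'-\theta|<\delta$; $f$ is $F$-continuous if $F\text{-}\lim_{\theta'\to\theta}f(\theta')=f(\theta)$ at each $\theta\in F$. $F^{\alpha}$-derivative: $D_F^{\alpha}f(\theta)=F\text{-}\lim_{\theta'\to\theta}\dfrac{f(\theta')-f(\theta)}{J(\theta')-J(\theta)}$ if this limit exists. Primitive and indefinite integral: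 a primitive of a function $h$ on $F$ is a function $H$ on $F$ with $D_F^{\alpha}H=h$; the indefinite fractal integral $\int h(\theta)\,d_F^{\alpha}\theta$ denotes a primitive of $h$. Solution: a function $y:F\to\mathbb{R}$ that has an $F^{\alpha}$-derivative at each point of $F$ and satisfies the equation. Integrating factor method: for $F$-continuous $p,g$ on $F$, the solutions of $D_F^{\alpha}y+p\,y=g$ are $y(\theta)=\big(\int m(\theta)g(\theta)\,d_F^{\alpha}\theta+C\big)/m(\theta)$, where $m(\theta)=\exp\big(\int p(\theta)\,d_F^{\alpha}\theta\big)$ is the integrating factor and $C$ is an arbitrary constant.
   Formalization: The printed formula in (iii) is false (e.g. y'=y²); here μ=e^{(1-β)Λ} and the numerator is (1-β)∫rμ+c. The mass of F is assumed finite and J injective, so D_F^α makes sense; the formula is for y>0, or y<0 if β=2, where both powers are defined and inverse. *)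

(* Defs.v *)
(* MathComp / MathComp-Analysis *)
From mathcomp Require Import all_boot all_order all_algebra.
From mathcomp Require Import all_classical all_reals all_analysis.

Set Implicit Arguments.
Unset Strict Implicit.
Unset Printing Implicit Defensive.

Import Order.TTheory GRing.Theory Num.Theory.
Import numFieldNormedType.Exports.

Local Open Scope classical_set_scope.
Local Open Scope ring_scope.

(* The library norm on row vectors is the sup norm, hence this definition;
   both norms induce the same topology. *)
Definition enorm (R : realType) (n : nat) (x : 'rV[R]_n) : R :=
  Num.sqrt (\sum_(i < n) x ord0 i ^+ 2).

Definition fractal_curve (R : realType) (n : nat) (a0 b0 : R)
    (w : R -> 'rV[R]_n) (F : set 'rV[R]_n) : Prop :=
  [/\ a0 < b0, {within `[a0, b0], continuous w} & set_bij `[a0, b0] F w].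

Definition Gamma (R : realType) (x : R) : R :=
  Rintegral (@lebesgue_measure R) `]0, +oo[ (fun t => t `^ (x - 1) * expR (- t)).

(* A subdivision a = t_0 < ... < t_m = b is represented by a :: s, where
   s = [:: t_1; ...; t_m]. *)
Definition mesh_le (R : realType) (a b : R) (s : seq R) (delta : R) : Prop :=
  forall i : nat, (i < size s)%N ->
    nth b (a :: s) i.+1 - nth b (a :: s) i <= delta.

Definition mass_sum (R : realType) (n : nat) (alpha : R) (w : R -> 'rV[R]_n)
    (a b : R) (s : seq R) : R :=
  \sum_(0 <= i < size s)
    enorm (w (nth b (a :: s) i.+1) - w (nth b (a :: s) i)) `^ alpha
      / Gamma (alpha + 1).

Definition coarse_mass (R : realType) (n : nat) (alpha : R)
    (w : R -> 'rV[R]_n) (a b delta : R) : \bar R :=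
  ereal_inf [set (mass_sum alpha w a b s)%:E | s in
    [set s | itv_partition a b s /\ mesh_le a b s delta]].

Definition mass (R : realType) (n : nat) (alpha : R) (w : R -> 'rV[R]_n)
    (a b : R) : \bar R :=
  lim (coarse_mass alpha w a b delta @[delta --> 0^'+]).

(* Only meaningful when mass alpha w a0 b0 is finite, [a0, b0] being the
   parameter interval: fine sends infinite values to 0. *)
Definition rise (R : realType) (n : nat) (alpha : R) (w : R -> 'rV[R]_n)
    (p0 u : R) : R :=
  if p0 <= u then fine (mass alpha w p0 u) else - fine (mass alpha w u p0).

(* xget returns the unique parameter u in [a0, b0] with w u = theta when theta
   lies on the curve. *)
Definition massJ (R : realType) (n : nat) (alpha a0 b0 : R)
    (w : R -> 'rV[R]_n) (p0 : R) (theta : 'rV[R]_n) : R :=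
  rise alpha w p0 (xget p0 [set u | u \in `[a0, b0] /\ w u = theta]).

Definition Flim (R : realType) (n : nat) (F : set 'rV[R]_n)
    (f : 'rV[R]_n -> R) (theta : 'rV[R]_n) (l : R) : Prop :=
  forall eps : R, 0 < eps -> exists2 delta : R, 0 < delta &
    forall theta', F theta' -> 0 < enorm (theta' - theta) < delta ->
      `|f theta' - l| < eps.

Definition Fcontinuous (R : realType) (n : nat) (F : set 'rV[R]_n)
    (f : 'rV[R]_n -> R) : Prop :=
  forall theta, F theta -> Flim F f theta (f theta).

(* The F^alpha-derivative of f at theta exists and equals l, where J is the
   mass of the curve.  Intended for J injective on F, so that the denominator
   vanishes at no theta' <> theta. *)
Definition is_Fderiv (R : realType) (n : nat) (F : set 'rV[R]_n)
    (J f : 'rV[R]_n -> R) (theta : 'rV[R]_n) (l : R) : Prop :=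
  Flim F (fun theta' => (f theta' - f theta) / (J theta' - J theta)) theta l.

Definition Fderivable (R : realType) (n : nat) (F : set 'rV[R]_n)
    (J f : 'rV[R]_n -> R) : Prop :=
  forall theta, F theta -> exists l, is_Fderiv F J f theta l.

Definition Fprimitive (R : realType) (n : nat) (F : set 'rV[R]_n)
    (J h H : 'rV[R]_n -> R) : Prop :=
  forall theta, F theta -> is_Fderiv F J H theta (h theta).

(* Real powers x ^ b of possibly negative x: integral b are ordinary powers
   (the library's powR is constantly 1 on negative bases). *)
Definition rpow (R : realType) (x b : R) : R :=
  if b \is a Num.int then x ^ Num.floor b else x `^ b.

(* x ^ b is a well-defined real number; 0 ^ 0 = 1. *)
Definition rpow_defined (R : realType) (x b : R) : Prop :=
  [\/ 0 < x, x = 0 /\ 0 <= b | x < 0 /\ b \is a Num.int].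

(* For nonzero b, the powers b and 1/b are defined and inverse to each other
   at x: this holds for x > 0, and for x < 0 exactly when b = 1 or b = -1. *)
Definition rpow_invertible (R : realType) (x b : R) : Prop :=
  [/\ x != 0, rpow_defined x b & rpow_defined x b^-1].

(* y solves D y + p y = g on F *)
Definition linear_solution (R : realType) (n : nat) (F : set 'rV[R]_n)
    (J p g y : 'rV[R]_n -> R) : Prop :=
  forall theta, F theta -> exists2 l, is_Fderiv F J y theta l &
    l + p theta * y theta = g theta.

(* y solves D y + q y = r y ^ beta on F; the power must make sense *)
Definition bernoulli_solution (R : realType) (n : nat) (F : set 'rV[R]_n)
    (J q r : 'rV[R]_n -> R) (beta : R) (y : 'rV[R]_n -> R) : Prop :=
  forall theta, F theta -> rpow_defined (y theta) beta /\
    exists2 l, is_Fderiv F J y theta l &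
      l + q theta * y theta = r theta * rpow (y theta) beta.

(* Main.v *)
Require Import Defs.
From mathcomp Require Import all_boot all_order all_algebra.
From mathcomp Require Import all_classical all_reals all_analysis.
From mathcomp Require Import ring lra.

(** Composing with the parametrization turns [is_Fderiv] into a derivative
    with respect to the function [S u := J (w u)] of the parameter, and the
    whole statement then follows the classical theory of Bernoulli equations,
    provided that [S] is a good change of variable.  The geometric half of the
    proof is about that.

    The mass of an arc is the limit of infima of sums over finer and finer
    partitions.  It is additive ([mu_add]): inserting a cut point into a
    fine partition costs at most two short chords, and these are negligible
    because the parametrization is uniformly continuous.  A finite mass is
    moreover uniformly continuous ([mu_small]): joining nearly optimal
    partitions of the two outer arcs by a single chord over a short middle arc
    gives a partition of the whole curve, so the middle arc carries hardly more
    mass than that chord costs.  Hence [S] is nondecreasing, and [J] is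
    continuous along the curve ([massJ_Fcontinuous]) since a continuous
    injection of a segment has a continuous inverse ([curve_inv_continuous]).

    Continuity of [J] makes differentiable functions continuous
    ([is_Fderiv_continuous]), which gives the product and chain rules.
    Monotonicity of [S] gives the mean value estimate [straddle_le], hence
    functions with zero derivative are constant ([Fprimitive0_cst]).

    The equations are then solved as usual.  If [P] is a primitive of [p] and
    [M] one of [g * expR P], then [z] solves the linear equation with
    coefficients [p] and [g] if and only if [z * expR P - M] has zero
    derivative ([linear_solutionP]).  Multiplying the Bernoulli equation by
    [(1 - beta) * y ^ (- beta)], which vanishes nowhere if [y] does not, gives
    the linear equation for [y ^ (1 - beta)] ([bernoulli_linear]).  The explicit
    formula combines both facts; it loses nothing where [y] can be recovered
    from [y ^ (1 - beta)] ([bernoulli_solutionP]). *)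

Set Implicit Arguments.
Unset Strict Implicit.
Unset Printing Implicit Defensive.

Import Order.TTheory GRing.Theory Num.Theory.
Import numFieldNormedType.Exports.

Local Open Scope classical_set_scope.
Local Open Scope ring_scope.

(** * Limits of partition sums of an interval cost *)

Section PartitionSums.
Variables (R : realType) (cost : R -> R -> R).
Hypothesis cost_ge0 : forall x y, 0 <= cost x y.
Implicit Types (a b c d e : R) (s t : seq R).

Definition part_sum a s : R := \sum_(v <- pairmap cost a s) v.

Lemma part_sum_nil a : part_sum a [::] = 0.
Proof. by rewrite /part_sum big_nil. Qed.

Lemma part_sum_cons a x s : part_sum a (x :: s) = cost a x + part_sum x s.
Proof. by rewrite /part_sum big_cons. Qed.

Lemma part_sum_ge0 a s : 0 <= part_sum a s.
Proof.
elim: s a => [|x s IH] a; first by rewrite part_sum_nil.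
by rewrite part_sum_cons addr_ge0.
Qed.

Lemma part_sum_cat a b s t : last a s = b ->
  part_sum a (s ++ t) = part_sum a s + part_sum b t.
Proof. by rewrite /part_sum pairmap_cat big_cat => ->. Qed.

Lemma mesh_le_cons a b x s d :
  mesh_le a b (x :: s) d <-> x - a <= d /\ mesh_le x b s d.
Proof.
split=> [h|[h1 h2] [|i] hi //=]; last exact: h2.
by split; [exact: (h 0%N)|move=> i hi; exact: (h i.+1)].
Qed.

Lemma mesh_le_cat a b c s t d : last a s = b ->
  mesh_le a b s d -> mesh_le b c t d -> mesh_le a c (s ++ t) d.
Proof.
elim: s a => [|x s IH] a /= h; first by rewrite h.
by move=> /mesh_le_cons[h1 h2] h3; apply/mesh_le_cons; split => //; exact: IH.
Qed.

Lemma mesh_le_trans a b s d e : d <= e -> mesh_le a b s d -> mesh_le a b s e.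
Proof. by move=> de h i hi; apply: le_trans de; exact: h. Qed.

Definition fine_partition a b d s := itv_partition a b s /\ mesh_le a b s d.

Lemma fine_partition_cat a b c d s t :
  fine_partition a b d s -> fine_partition b c d t ->
  fine_partition a c d (s ++ t).
Proof.
move=> [s1 s2] [t1 t2]; split; first exact: itv_partition_cat s1 t1.
by apply: mesh_le_cat s2 t2; case: s1 => _ /eqP.
Qed.

Lemma fine_partition_trans a b d e s :
  d <= e -> fine_partition a b d s -> fine_partition a b e s.
Proof. by move=> de [? h]; split => //; exact: mesh_le_trans h. Qed.

(** The limit of the infima of partition sums is used only through [muP], in
    which the limit and the infimum have become quantifiers over real
    numbers. *)
Variable mu : R -> R -> \bar R.
Hypothesis mu_ge0 : forall a b, (0 <= mu a b)%E.
Hypothesis muP : forall a b M, (mu a b <= M%:E)%E <->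
  forall d e, 0 < d -> 0 < e ->
  exists2 s, fine_partition a b d s & part_sum a s < M + e.

Lemma mu_fineK a b : (mu a b < +oo)%E ->
  mu a b = (fine (mu a b))%:E.
Proof. by move=> h; rewrite fineK// ge0_fin_numE// mu_ge0. Qed.

Lemma mu_le_fine a b : (mu a b < +oo)%E -> (mu a b <= (fine (mu a b))%:E)%E.
Proof. by move=> /mu_fineK <-. Qed.

(** Near optimality from below: the other half of the meaning of the limit of
    infima, read off the negation of [muP]. *)
Lemma mu_gt_part_sum a b M : (M%:E < mu a b)%E ->
  exists2 d, 0 < d & forall s, fine_partition a b d s ->
    M < part_sum a s.
Proof.
move=> h; have : ~ (mu a b <= M%:E)%E by apply/negP; rewrite -ltNge.
move=> /muP/existsNP[d] /existsNP[e] /not_implyP[d0] /not_implyP[e0 hn].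
exists d => // s hs; rewrite ltNge; apply/negP => hM; apply: hn; exists s => //.
by rewrite (le_lt_trans hM)// ltrDl.
Qed.

Variables (a0 b0 : R).
(** The only link between the cost and the segment: short steps are cheap. *)
Hypothesis cost_small : forall e, 0 < e -> exists2 d, 0 < d &
  forall x y, a0 <= x -> x < y -> y <= b0 -> y - x <= d -> cost x y <= e.

(** At most one step of the partition straddles the cut point [b].  It is
    replaced by two steps ending and starting at [b], each of length at most
    [d] and hence of cost at most [eta]. *)
Lemma fine_partition_split eta d a b c s :
  (forall x y, a0 <= x -> x < y -> y <= b0 -> y - x <= d ->
     cost x y <= eta) -> 0 <= eta ->
  a0 <= a -> a <= b -> b <= c -> c <= b0 -> fine_partition a c d s ->
  exists s1 s2, [/\ fine_partition a b d s1, fine_partition b c d s2 &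
    part_sum a s1 + part_sum b s2
    <= part_sum a s + eta + eta].
Proof.
move=> heta eta0; elim: s a => [|x s IH] a ha ab bc cb hs.
  have ac : a = c by case: hs => /itv_partition_nil.
  have ba : a = b by apply/le_anti; rewrite ab ac bc.
  exists [::], [::]; subst b; subst c; split => //.
  by rewrite !part_sum_nil; lra.
move: ab; rewrite le_eqVlt => /predU1P[ab|ab].
  exists [::], (x :: s); subst b; split => //.
  by rewrite part_sum_nil; lra.
have [[/= /andP[ax xs] xc] /mesh_le_cons[xa ms]] := hs.
(* Either the first step stays on the left of b, or it is the straddling one. *)
have [xb|bx] := leP x b.
  have hax : a0 <= x by apply: le_trans ha (ltW ax).
  have [s1 [s2 [p1 p2 hle]]] := IH x hax xb bc cb (conj (conj xs xc) ms).
  exists (x :: s1), s2; split; [|exact: p2|by rewrite !part_sum_cons; lra].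
  case: p1 => -[q1 q2] q3; split; last exact/mesh_le_cons.
  by split; [rewrite /= ax|].
have xb0 : x <= b0.
  by apply: le_trans cb; apply: itv_partition_le (conj xs xc).
exists [:: b], (x :: s); split.
- by split; [exact: itv_partition1|apply/mesh_le_cons; split => //; lra].
- split; first by split => //=; rewrite bx.
  by apply/mesh_le_cons; split => //; lra.
have h1 : cost a b <= eta by apply: heta => //; lra.
have h2 : cost b x <= eta by apply: heta => //; lra.
have := cost_ge0 a x.
by rewrite !part_sum_cons part_sum_nil; lra.
Qed.

Lemma mu_subadd a b c Mab Mbc :
  (mu a b <= Mab%:E)%E -> (mu b c <= Mbc%:E)%E ->
  (mu a c <= (Mab + Mbc)%:E)%E.
Proof.
move=> /muP h1 /muP h2; apply/muP => d e d0 e0.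
have e20 : 0 < e / 2 by rewrite divr_gt0.
have [s1 p1 l1] := h1 d _ d0 e20; have [s2 p2 l2] := h2 d _ d0 e20.
exists (s1 ++ s2); first exact: fine_partition_cat p2.
rewrite (@part_sum_cat _ b); last by case: p1 => -[_ /eqP].
by lra.
Qed.

(** Both parts are controlled by one partition of the whole interval, which is
    what superadditivity needs. *)
Lemma mu_split a b c M : a0 <= a -> a <= b -> b <= c -> c <= b0 ->
  (mu a c <= M%:E)%E -> forall d e, 0 < d -> 0 < e ->
  exists s1 s2, [/\ fine_partition a b d s1, fine_partition b c d s2 &
    part_sum a s1 + part_sum b s2 < M + e].
Proof.
move=> ha ab bc cb /muP h d e d0 e0.
have [|d1 d10 hd1] := @cost_small (e / 4); first lra.
have dd0 : 0 < Num.min d d1 by rewrite lt_min d0.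
have [|s hs l] := h (Num.min d d1) (e / 2) dd0; first lra.
have [||s1 [s2 [p1 p2 l2]]] :=
   @fine_partition_split (e / 4) (Num.min d d1) a b c s _ _ ha ab bc cb hs.
- by move=> x y ? ? ?; rewrite le_min => /andP[_ ?]; exact: hd1.
- lra.
have dm : Num.min d d1 <= d by rewrite ge_min lexx.
by exists s1, s2; split; [exact: fine_partition_trans p1
  |exact: fine_partition_trans p2|lra].
Qed.

Lemma mu_le_sub a b c d : a0 <= a -> a <= b -> b <= c -> c <= d -> d <= b0 ->
  (mu a d < +oo)%E -> (mu b c <= mu a d)%E.
Proof.
move=> ha ab bc cd db fin; rewrite (mu_fineK fin).
have hM := mu_split ha (le_trans ab bc) cd db.
have := le_refl (mu a d); rewrite {2}(mu_fineK fin) => {}/hM hM.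
have {}hM : (mu a c <= (fine (mu a d))%:E)%E.
  apply/muP => dd e d0 e0; have [s1 [s2 [p1 p2 l]]] := hM dd e d0 e0.
  by exists s1 => //; have := part_sum_ge0 c s2; lra.
apply/muP => dd e d0 e0.
have [s1 [s2 [p1 p2 l]]] := mu_split ha ab bc (le_trans cd db) hM d0 e0.
by exists s2 => //; have := part_sum_ge0 a s1; lra.
Qed.

Hypothesis mu_fin : (mu a0 b0 < +oo)%E.

Lemma mu_fin_sub a b : a0 <= a -> a <= b -> b <= b0 ->
  (mu a b < +oo)%E.
Proof.
move=> ha ab hb; apply: le_lt_trans mu_fin.
by apply: mu_le_sub => //.
Qed.

Let m a b := fine (mu a b).

(** The nontrivial inequality is superadditivity.  A nearly optimal partition of
    [[a, c]] is split at [b]; its right part costs at least [m b c - e / 2] once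
    the mesh is small, which bounds the left part. *)
Lemma mu_add a b c : a0 <= a -> a <= b -> b <= c -> c <= b0 ->
  m a c = m a b + m b c.
Proof.
move=> ha ab bc cb.
have fab : (mu a b < +oo)%E.
  by apply: mu_fin_sub => //; exact: le_trans cb.
have fbc : (mu b c < +oo)%E.
  by apply: mu_fin_sub => //; exact: le_trans ab.
have fac : (mu a c < +oo)%E.
  by apply: mu_fin_sub => //; exact: le_trans bc.
apply/le_anti/andP; split.
  rewrite -lee_fin -(mu_fineK fac).
  by apply: (@mu_subadd _ b); rewrite -mu_fineK.
have hac : (mu a c <= (m a c)%:E)%E by rewrite -mu_fineK.
rewrite -lerBrDr -lee_fin -(mu_fineK fab); apply/muP => d e d0 e0.
have [|d1 d10 hd1] := @mu_gt_part_sum b c (m b c - e / 2).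
  by rewrite (mu_fineK fbc) lte_fin /m; lra.
have [||s1 [s2 [p1 p2 l]]] :=
  mu_split ha ab bc cb hac (d := Num.min d d1) (e := e / 2).
- by rewrite lt_min d0.
- lra.
exists s1; first by apply: fine_partition_trans p1; rewrite ge_min lexx.
have := hd1 s2; have dm : Num.min d d1 <= d1 by rewrite ge_min lexx orbT.
by move=> /(_ (fine_partition_trans dm p2)); lra.
Qed.

(** Otherwise one could save mass: a short middle arc [[u, v]] may be crossed in
    one step of negligible cost, whereas the outer arcs cost about their
    masses, and the total cannot be much smaller than the mass of the whole. *)
Lemma mu_small e : 0 < e -> exists2 d, 0 < d &
  forall u v, a0 <= u -> u < v -> v <= b0 -> v - u <= d -> m u v < e.
Proof.
move=> e0; have [|d1 d10 hd1] := @mu_gt_part_sum a0 b0 (m a0 b0 - e / 2).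
  by rewrite (mu_fineK mu_fin) lte_fin /m; lra.
have [|d2 d20 hd2] := @cost_small (e / 8); first lra.
exists (Num.min d1 d2); first by rewrite lt_min d10.
move=> u v au uv vb; rewrite le_min => /andP[uv1 uv2].
have e80 : 0 < e / 8 by lra.
have c1 := hd2 _ _ au uv vb uv2.
have fau : (mu a0 u < +oo)%E.
  by apply: mu_fin_sub => //; apply: ltW; exact: lt_le_trans vb.
have fvb : (mu v b0 < +oo)%E.
  by apply: mu_fin_sub => //; apply: ltW; exact: le_lt_trans uv.
have [s1 p1 l1] := (muP a0 u _).1 (mu_le_fine fau) _ _ d10 e80.
have [s2 p2 l2] := (muP v b0 _).1 (mu_le_fine fvb) _ _ d10 e80.
have p : fine_partition a0 b0 d1 (s1 ++ [:: v] ++ s2).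
  apply: fine_partition_cat p1 _; apply: fine_partition_cat p2.
  by split; [exact: itv_partition1|apply/mesh_le_cons].
have := hd1 _ p.
rewrite (@part_sum_cat _ u); last by case: p1 => -[_ /eqP].
rewrite (@part_sum_cat _ v)// part_sum_cons part_sum_nil.
have := @mu_add a0 u b0 (lexx _) au (ltW (lt_le_trans uv vb)) (lexx _).
have := @mu_add u v b0 au (ltW uv) vb (lexx _).
by rewrite /m; lra.
Qed.

End PartitionSums.

(** * The mass as a limit of partition sums *)

Section Mass.
Variables (R : realType) (n : nat) (alpha : R) (w : R -> 'rV[R]_n).
Implicit Types (a b d e x y : R) (s : seq R).

Definition chord_cost x y : R :=
  enorm (w y - w x) `^ alpha / Gamma (alpha + 1).

Lemma Gamma_ge0 (x : R) : 0 <= Gamma x.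
Proof.
rewrite /Gamma; apply: Rintegral_ge0 => t _.
by rewrite mulr_ge0 ?powR_ge0 ?expR_ge0.
Qed.

Lemma chord_cost_ge0 x y : 0 <= chord_cost x y.
Proof. by rewrite /chord_cost divr_ge0 ?powR_ge0 ?Gamma_ge0. Qed.

Lemma mass_sumE a b s : mass_sum alpha w a b s = part_sum chord_cost a s.
Proof.
elim: s a => [|x s IH] a; first by rewrite /mass_sum big_geq// part_sum_nil.
by rewrite part_sum_cons -IH /mass_sum /= big_nat_recl.
Qed.

(** Allowing a larger mesh enlarges the set of partitions, so the infimum
    is a nonincreasing function of the mesh and its limit at zero is a
    supremum. *)
Lemma coarse_mass_cvg a b :
  coarse_mass alpha w a b d @[d --> 0^'+] -->
  ereal_sup (coarse_mass alpha w a b @` [set` `]0, +oo[]).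
Proof.
apply: nonincreasing_at_right_cvge; first by [].
move=> x y _ _ xy; apply: le_ereal_inf => _ [s [s1 s2] <-].
by exists s => //; split => //; exact: mesh_le_trans s2.
Qed.

Lemma mass_sup a b :
  mass alpha w a b = ereal_sup (coarse_mass alpha w a b @` [set` `]0, +oo[]).
Proof. by apply/cvg_lim => //; exact: coarse_mass_cvg. Qed.

Lemma massP a b M : (mass alpha w a b <= M%:E)%E <->
  forall d e, 0 < d -> 0 < e -> exists2 s, fine_partition a b d s &
    part_sum chord_cost a s < M + e.
Proof.
rewrite mass_sup; split => [h d e d0 e0|h].
  have hd : (coarse_mass alpha w a b d <= M%:E)%E.
    apply: le_trans h; apply: ereal_sup_ubound; exists d => //=.
    by rewrite in_itv/= d0.
  have /ereal_inf_lt[_ [s [s1 s2] <-]] :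
      (coarse_mass alpha w a b d < (M + e)%:E)%E.
    by apply: le_lt_trans hd _; rewrite lte_fin ltrDl.
  by rewrite lte_fin mass_sumE; exists s.
apply: ge_ereal_sup => _ [d + <-]; rewrite /= in_itv/= andbT => d0.
apply/lee_addgt0Pr => e e0.
have [s hs hlt] := h d e d0 e0.
apply: le_trans (_ : (part_sum chord_cost a s)%:E <= _)%E.
  by apply: ereal_inf_lbound; exists s; rewrite ?mass_sumE.
by rewrite -EFinD lee_fin ltW.
Qed.

Lemma mass_ge0 a b : (0 <= mass alpha w a b)%E.
Proof.
rewrite mass_sup.
apply: le_trans (_ : coarse_mass alpha w a b 1 <= _)%E.
  apply: le_ereal_inf_tmp => _ [s _ <-]; rewrite lee_fin mass_sumE.
  by apply: part_sum_ge0; exact: chord_cost_ge0.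
by apply: ereal_sup_ubound; exists 1 => //=; rewrite in_itv/= ltr01.
Qed.

End Mass.

(** * Euclidean norm and limits along the curve *)

Section EuclideanNorm.
Variables (R : realType) (n : nat).
Implicit Types x : 'rV[R]_n.

Lemma enorm_ge0 x : 0 <= enorm x.
Proof. exact: sqrtr_ge0. Qed.

Lemma le_norm_enorm x : `|x| <= enorm x.
Proof.
rewrite [leLHS]/Num.norm /= mx_normrE; apply/bigmax_leP; split=> [|[i j] _ /=].
  exact: enorm_ge0.
rewrite -sqrtr_sqr ler_wsqrtr// (ord1 i) (bigD1 j)//= lerDl.
by apply: sumr_ge0 => k _; exact: sqr_ge0.
Qed.

Lemma le_enorm_norm x : enorm x <= (Num.sqrt n%:R + 1) * `|x|.
Proof.
apply: le_trans (_ : Num.sqrt n%:R * `|x| <= _); last first.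
  by rewrite ler_wpM2r// lerDl.
have hx : `|x| = Num.sqrt (`|x| ^+ 2) by rewrite sqrtr_sqr normr_id.
rewrite hx -sqrtrM// ler_wsqrtr//.
apply: le_trans (_ : \sum_(i < n) `|x| ^+ 2 <= _); last first.
  by rewrite sumr_const card_ord mulr_natl.
apply: ler_sum => i _; rewrite -[leLHS]real_normK ?num_real// lerXn2r ?nnegrE//.
rewrite [leRHS]/Num.norm /= mx_normrE.
by apply/bigmax_geP; right; exists (ord0, i).
Qed.

Lemma enorm_small (e : R) : 0 < e ->
  exists2 d : R, 0 < d & forall x, `|x| < d -> enorm x < e.
Proof.
move=> e0; have s0 : 0 < Num.sqrt n%:R + 1 :> R by rewrite ltr_wpDl.
exists (e / (Num.sqrt n%:R + 1)); first by rewrite divr_gt0.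
move=> x; rewrite ltr_pdivlMr// mulrC; apply: le_lt_trans.
exact: le_enorm_norm.
Qed.

End EuclideanNorm.

Section FlimFilter.
Variables (R : realType) (n : nat) (F : set 'rV[R]_n).

(** The Euclidean norm and the sup norm have the same null filters, so fractal
    limits are limits along the punctured neighbourhoods traced on [F], and
    the filter library applies. *)
Lemma Flim_cvg (f : 'rV[R]_n -> R) t l :
  Flim F f t l <-> f @ within F t^' --> l.
Proof.
split=> [h|/cvgrPdistC_lt h e e0].
  apply/cvgrPdistC_lt => e e0; have [d d0 hd] := h e e0.
  have [d' d'0 hd'] := enorm_small n d0.
  have : \forall t' \near t, t' != t -> F t' -> `|f t' - l| < e.
    apply/nbhs_ballP; exists d' => //= t'; rewrite -ball_normE /= => tt' nt Ft'.
    apply: hd => //; rewrite hd' 1?distrC// andbT.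
    by rewrite (lt_le_trans _ (le_norm_enorm _))// normr_gt0 subr_eq0.
  by [].
have /= /nbhs_ballP[d /= d0 hd] := h e e0.
exists d => // t' Ft' /andP[tt0 ttd]; apply: hd => //.
  by rewrite -ball_normE /= distrC (le_lt_trans (le_norm_enorm _)).
apply/eqP => tt; move: tt0; rewrite tt subrr.
have /eqP -> : enorm (0 : 'rV[R]_n) == 0.
  by rewrite sqrtr_eq0 big1// => i _; rewrite mxE expr0n.
by rewrite ltxx.
Qed.

End FlimFilter.

(** * Geometry of the curve and of its mass *)

Section Curve.
Variables (R : realType) (n : nat) (alpha : R).
Hypothesis alpha_ge1 : 1 <= alpha.
Variables (a0 b0 : R) (w : R -> 'rV[R]_n) (F : set 'rV[R]_n).
Hypothesis hF : fractal_curve a0 b0 w F.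

Let K : set R := `[a0, b0].

Lemma curve_unif_continuous (e : R) : 0 < e -> exists2 d : R, 0 < d &
  forall x y, K x -> K y -> `|y - x| <= d -> `|w y - w x| < e.
Proof.
move=> e0; case: hF => _ /subspace_continuousP wc _.
have cK : near_covering K.
  by apply/compact_near_coveringP; exact: segment_compact.
pose P (d : R) (x : R) := K x ->
  forall y, K y -> `|y - x| <= d -> `|w y - w x| < e.
have : \forall d \near 0^'+, K `<=` P d.
  apply: cK => x Kx.
  have e20 : 0 < e / 2 by rewrite divr_gt0.
  have /cvgrPdist_lt/(_ _ e20)/nbhs_ballP[d /= d0 hd] := wc x Kx.
  have d20 : 0 < d / 2 by rewrite divr_gt0.
  exists (ball x (d / 2), [set r | r < d / 2]).
    by split => /=; [exact: nbhsx_ballx|exact: nbhs_right_lt].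
  move=> [x' r] [] /=; rewrite -ball_normE /= => xx' rd Kx' y Ky yx'.
  have h1 : `|w x - w x'| < e / 2.
    by apply: hd => //; rewrite -ball_normE /=; lra.
  have h2 : `|w x - w y| < e / 2.
    apply: hd => //; rewrite -ball_normE /=.
    rewrite (_ : x - y = (x - x') - (y - x')); last by ring.
    by apply: le_lt_trans (ler_normB _ _) _; lra.
  rewrite (_ : w y - w x' = (w x - w x') - (w x - w y)); last first.
    by rewrite opprB [RHS]addrC addrA subrK.
  by apply: le_lt_trans (ler_normB _ _) _; lra.
move=> H; have [d /= [Kd d0]] : exists d : R, (K `<=` P d) /\ 0 < d.
  near (0:R)^'+ => d; exists d; split; last by [].
  by near: d.
by exists d => // x y Kx; exact: Kd.
Unshelve. all: by end_near. Qed.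

(** Since [1 <= alpha], a chord of length at most one has a power [alpha] below
    its length. *)
Lemma chord_cost_small (e : R) : 0 < e -> exists2 d : R, 0 < d &
  forall x y, a0 <= x -> x < y -> y <= b0 -> y - x <= d ->
  chord_cost alpha w x y <= e.
Proof.
move=> e0; set G := (Gamma (alpha + 1))^-1.
have G0 : 0 <= G by rewrite invr_ge0 Gamma_ge0.
have m0 : 0 < Num.min 1 (e / (G + 1)).
  by rewrite lt_min ltr01 divr_gt0// ltr_wpDl.
have [d1 d10 hd1] := enorm_small n m0.
have [d d0 hd] := curve_unif_continuous d10.
exists d => // x y ax xy yb xyd.
have : enorm (w y - w x) < Num.min 1 (e / (G + 1)).
  apply/hd1/hd; rewrite /K/= ?in_itv/=.
  - by rewrite ax (le_trans (ltW xy)).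
  - by rewrite yb (le_trans ax (ltW xy)).
  - by rewrite gtr0_norm// subr_gt0.
rewrite lt_min /chord_cost -/G; move: (enorm_ge0 (w y - w x)).
rewrite le_eqVlt => /predU1P[<- _|h0 /andP[h1 h2]].
  by rewrite powR0 ?mul0r ?ltW// gt_eqF// (lt_le_trans _ alpha_ge1).
apply: le_trans (_ : enorm (w y - w x) * G <= _).
  by rewrite ler_wpM2r// ge1r_powR// h0 ltW.
apply: le_trans (_ : enorm (w y - w x) * (G + 1) <= _).
  by rewrite ler_wpM2l ?lerDl// ltW.
by rewrite -ler_pdivlMr ?ltr_wpDl// ltW.
Qed.

(** Points of the segment away from [u] have images away from [w u], by
    injectivity; compactness makes this uniform. *)
Lemma curve_inv_continuous (u d : R) : K u -> 0 < d ->
  \forall t \near w u, forall v, K v -> w v = t -> `|v - u| < d.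
Proof.
move=> Ku d0; case: hF => _ /subspace_continuousP wc [_ winj _].
have cK : near_covering K.
  by apply/compact_near_coveringP; exact: segment_compact.
pose P (t : 'rV[R]_n) v := K v -> w v = t -> `|v - u| < d.
suff : \forall t \near w u, K `<=` P t.
  by apply: filterS => t h v Kv; exact: h.
apply: (cK _ (nbhs (w u)) P) => v Kv; have [->|vu] := eqVneq v u.
  exists (ball u d, setT).
    by split => /=; [exact: nbhsx_ballx|exact: filterT].
  by move=> [v' t] [] /=; rewrite -ball_normE /P /= => h _ _ _; rewrite distrC.
have r0 : 0 < `|w v - w u| / 2.
  rewrite divr_gt0// normr_gt0 subr_eq0; apply: contra_neq vu => h.
  by apply: winj; rewrite ?inE.
have /cvgrPdist_lt/(_ _ r0) hv := wc v Kv.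
exists ([set v' | K v' -> `|w v - w v'| < `|w v - w u| / 2],
        ball (w u) (`|w v - w u| / 2)).
  by split => //=; exact: nbhsx_ballx.
move=> [v' t] [] /=; rewrite -ball_normE /= => hv' ht Kv' wt.
exfalso; have {}hv' := hv' Kv'; rewrite -wt in ht.
have : `|w v - w u| <= `|w v - w v'| + `|w u - w v'|.
  rewrite [in leRHS](distrC (w u)).
  by rewrite (le_trans _ (ler_normD _ _))// addrA subrK.
lra.
Qed.

(** No point of the curve is isolated, so limits along it are unique. *)
Lemma curve_proper t : F t -> ProperFilter (within F t^').
Proof.
case: hF => ab /subspace_continuousP wc [wF winj wsurj] Ft.
have [u Ku <-] : (w @` K) t by exact: wsurj.
split=> [h|]; last exact: within_filter.
have {}h : \forall t' \near w u, t' != w u -> F t' -> False by exact: h.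
have /nbhs_ballP[d /= d0 hd] := wc u Ku _ h.
pose s := Num.min (d / 2) ((b0 - a0) / 2).
have s0 : 0 < s by rewrite lt_min !divr_gt0// subr_gt0.
have sd : s <= d / 2 by rewrite ge_min lexx.
have sb : s <= (b0 - a0) / 2 by rewrite ge_min lexx orbT.
move: (Ku); rewrite /K /= in_itv/= => /andP[au ub].
have [v [Kv vu vd]] : exists v, [/\ K v, v != u & `|u - v| < d].
  (* s is at most half the length of the segment: a step to the right or to
     the left stays inside. *)
  have [h1|h1] := leP (u + s) b0.
    exists (u + s); split.
    + by rewrite /K/= in_itv/=; apply/andP; split; lra.
    + by rewrite gt_eqF// ltrDl.
    + by rewrite opprD addrA subrr add0r normrN gtr0_norm//; lra.
  exists (u - s); split; first by rewrite /K/= in_itv/=; apply/andP; split; lra.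
    by rewrite lt_eqF// gtrBl.
  by rewrite opprB addrCA subrr addr0 gtr0_norm//; lra.
apply: (hd v _ Kv); first by rewrite -ball_normE.
  by apply: contra_neq vu => wv; apply: winj; rewrite ?inE.
exact: wF.
Qed.

Variable p0 : R.
Hypothesis hp0 : p0 \in `[a0, b0].
Hypothesis hfin : (mass alpha w a0 b0 < +oo)%E.

Let J := massJ alpha a0 b0 w p0.

Let m a b := fine (mass alpha w a b).

Lemma mass_additive a b c : a0 <= a -> a <= b -> b <= c -> c <= b0 ->
  m a c = m a b + m b c.
Proof.
exact: (mu_add (@chord_cost_ge0 _ _ alpha w) (@mass_ge0 _ _ alpha w)
  (@massP _ _ alpha w) chord_cost_small hfin).
Qed.

(** The sign convention for [u < p0] makes this hold on both sides of [p0], and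
    then only differences of [J] matter. *)
Lemma massJ_curve u : K u -> J (w u) = m a0 u - m a0 p0.
Proof.
move=> Ku; case: hF => _ _ [_ winj _].
have xu : xget p0 [set v | v \in `[a0, b0] /\ w v = w u] = u.
  case: xgetP => [v _ [Kv vu]|/(_ u)[]] //.
  by apply: winj; rewrite ?inE.
rewrite /J /massJ xu /rise; move: Ku hp0; rewrite /K/= !in_itv/=.
move=> /andP[au ub] /andP[ap pb]; case: leP => [pu|/ltW up].
  by rewrite -/(m p0 u) (mass_additive (lexx _) ap pu ub) addrC addKr.
by rewrite -/(m u p0) (mass_additive (lexx _) au up pb) opprD addNKr.
Qed.

Lemma massJ_diff u v : a0 <= u -> u <= v -> v <= b0 ->
  J (w v) - J (w u) = m u v.
Proof.
move=> au uv vb; rewrite !massJ_curve /K/= ?in_itv/=; first last.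
- by rewrite (le_trans au)//.
- by rewrite au (le_trans uv).
by rewrite opprB addrA subrK (mass_additive (lexx _) au uv vb) addrC addKr.
Qed.

Lemma massJ_homo u v : a0 <= u -> u <= v -> v <= b0 -> J (w u) <= J (w v).
Proof.
move=> au uv vb; rewrite -subr_ge0 massJ_diff//.
by apply: fine_ge0; exact: mass_ge0.
Qed.

(** Neighbouring points of the curve have neighbouring parameters, and a short
    arc has small mass. *)
Lemma massJ_Fcontinuous : Fcontinuous F J.
Proof.
move=> t Ft; apply/Flim_cvg.
case: hF => _ _ [wF winj wsurj].
have [u Ku <-] : (w @` K) t by exact: wsurj.
apply/cvgrPdistC_lt => e e0.
have [d d0 hd] := mu_small (@chord_cost_ge0 _ _ alpha w)
  (@mass_ge0 _ _ alpha w) (@massP _ _ alpha w) chord_cost_small hfin e0.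
suff : \forall t' \near w u, t' != w u -> F t' -> `|J t' - J (w u)| < e by [].
apply: filterS (curve_inv_continuous Ku d0) => t' ht tu Ft'.
have [v Kv vt] : (w @` K) t' by exact: wsurj.
have {}ht := ht v Kv vt; rewrite -vt {vt Ft'} in tu *.
move: (Ku) (Kv) => /=; rewrite /K /= !in_itv /= => /andP[au ub] /andP[av vb].
have [uv|vu|uv] := ltgtP u v; last by rewrite uv eqxx in tu.
- rewrite massJ_diff// ?(ltW uv)// ger0_norm ?fine_ge0 ?mass_ge0//.
  by apply: hd => //; rewrite ltW// (le_lt_trans (ler_norm _)).
- rewrite distrC massJ_diff// ?(ltW vu)// ger0_norm ?fine_ge0 ?mass_ge0//.
  by apply: hd => //; rewrite ltW// (le_lt_trans (ler_norm _))// distrC.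
Qed.

Hypothesis hinj : set_inj F J.

(** A mean value inequality with respect to a nondecreasing [S]:
    the supremum of the points at which the estimate with origin [a0] holds is
    itself such a point, and unless it is [x], some larger point is another. *)
Lemma straddle_le (g S : R -> R) (e : R) : 0 <= e ->
  (forall u v, a0 <= u -> u <= v -> v <= b0 -> S u <= S v) ->
  (forall u, K u -> exists2 d, 0 < d & forall v, K v -> `|v - u| < d ->
     `|g v - g u| <= e * `|S v - S u|) ->
  forall x, K x -> `|g x - g a0| <= e * (S x - S a0).
Proof.
move=> e0 Smono hloc x; rewrite {1}/K /= in_itv /= => /andP[ax xb].
pose E : set R := [set u | a0 <= u <= x /\ `|g u - g a0| <= e * (S u - S a0)].
have Ea : E a0 by split; [rewrite lexx ax|rewrite !subrr normr0 mulr0].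
have Ex : ubound E x by move=> u [/andP[]].
have supE : has_sup E by split; [exists a0|exists x].
pose c := sup E.
have ac : a0 <= c by apply: sup_upper_bound.
have cx : c <= x by apply: ge_sup => //; exists a0.
have [d d0 hd] : exists2 d, 0 < d & forall v, K v -> `|v - c| < d ->
     `|g v - g c| <= e * `|S v - S c|.
  by apply: hloc; rewrite /K /= in_itv /= ac (le_trans cx).
have step u v : a0 <= u -> u <= v -> v <= b0 ->
    `|g v - g u| <= e * `|S v - S u| -> `|g u - g a0| <= e * (S u - S a0) ->
    `|g v - g a0| <= e * (S v - S a0).
  move=> au uv vb; rewrite [`|S v - S u|]ger0_norm ?subr_ge0 ?Smono// => h1 h2.
  rewrite (_ : g v - g a0 = (g v - g u) + (g u - g a0)); last by ring.
  by apply: le_trans (ler_normD _ _) _; lra.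
have Ec : E c.
  split; first by rewrite ac.
  have [u Eu uc] := sup_adherent d0 supE; have [/andP[au ux] hu] := Eu.
  have uc' : u <= c by exact: sup_upper_bound.
  apply: (step u) => //; first exact: le_trans xb.
  rewrite distrC [`|S c - S u|]distrC; apply: hd.
    by rewrite /K /= in_itv /= au (le_trans ux).
  by rewrite ler0_norm ?subr_le0//; rewrite /c in uc' *; lra.
move: cx; rewrite le_eqVlt => /predU1P[<-|cx]; first by case: Ec.
pose v := Num.min x (c + d / 2).
have cv : c < v by rewrite lt_min cx ltrDl divr_gt0.
have vx : v <= x by rewrite ge_min lexx.
have vd : v <= c + d / 2 by rewrite ge_min lexx orbT.
have Ev : E v.
  split; first by rewrite vx (le_trans ac (ltW cv)).
  apply: (step c) => //; [exact: ltW|exact: le_trans xb| |by case: Ec].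
  apply: hd.
    by rewrite /K /= in_itv /= (le_trans ac (ltW cv)) (le_trans vx).
  by rewrite gtr0_norm ?subr_gt0//; lra.
by have := sup_upper_bound supE Ev; rewrite leNgt cv.
Qed.

(** The estimate of [straddle_le] holds for every positive slope. *)
Lemma Fprimitive0_cst (f : 'rV[R]_n -> R) : Fprimitive F J (fun=> 0) f ->
  exists c, forall t, F t -> f t = c.
Proof.
move=> hf; case: hF => ab /subspace_continuousP wc [wF winj wsurj].
have loc e u : 0 < e -> K u -> exists2 d, 0 < d & forall v, K v ->
    `|v - u| < d -> `|f (w v) - f (w u)| <= e * `|J (w v) - J (w u)|.
  move=> e0 Ku; have /Flim_cvg/cvgrPdistC_lt h := hf _ (wF _ Ku).
  have {}h : \forall t \near w u, t != w u -> F t ->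
      `|(f t - f (w u)) / (J t - J (w u)) - 0| < e by exact: (h e e0).
  have /nbhs_ballP[d /= d0 hd] := wc u Ku _ h; exists d => // v Kv vu.
  have [->|nvu] := eqVneq v u; first by rewrite !subrr normr0 mulr0.
  have nw : w v != w u.
    by apply: contra_neq nvu => wv; apply: winj; rewrite ?inE.
  have nJ : J (w v) - J (w u) != 0.
    rewrite subr_eq0; apply: contra_neq nw => Jvu.
    exact: hinj (mem_set (wF _ Kv)) (mem_set (wF _ Ku)) Jvu.
  have := hd v _ Kv nw (wF _ Kv); rewrite -ball_normE /= distrC => /(_ vu).
  by rewrite subr0 normrM normfV ltr_pdivrMr ?normr_gt0// => /ltW.
exists (f (w a0)) => t Ft; have [u Ku <-] : (w @` K) t by exact: wsurj.
apply/eqP; rewrite -subr_eq0 -normr_le0.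
apply/ler_addgt0Pr => e e0; rewrite add0r.
have D0 : 0 <= J (w u) - J (w a0).
  by move: Ku; rewrite /K/= in_itv/= => /andP[? ?]; rewrite subr_ge0 massJ_homo.
(* With this slope the total bound is at most e; the added 1 avoids a
   division by zero when u = a0. *)
have e'0 : 0 < e / (J (w u) - J (w a0) + 1) by rewrite divr_gt0// ltr_wpDl.
apply: le_trans (straddle_le (g := f \o w) (S := J \o w) (ltW e'0) _ _ Ku) _.
- exact: massJ_homo.
- by move=> v Kv; exact: loc.
rewrite mulrAC ler_pdivrMr ?ltr_wpDl//= ler_wpM2l ?(ltW e0)//.
by rewrite lerDl.
Qed.

End Curve.

(** * Real powers, including integral powers of negative numbers *)

Section RealPower.
Variable R : realType.
Implicit Types x b c : R.

Lemma rpow_pos x b : 0 < x -> rpow x b = x `^ b.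
Proof.
move=> x0; rewrite /rpow; case: ifPn => // bi.
by rewrite -powR_intmul ?ltW// floorK.
Qed.

Lemma rpow_intr x (z : int) : rpow x z%:~R = x ^ z.
Proof. by rewrite /rpow intr_int intrKfloor. Qed.

Lemma rpow_definedP x b : x != 0 -> rpow_defined x b ->
  0 < x \/ exists z : int, b = z%:~R.
Proof.
move=> x0 [|[/eqP]|[_ /intrP[z ->]]]; first by left.
  by rewrite (negbTE x0).
by right; exists z.
Qed.

Lemma rpow_definedI x b : (0 < x \/ exists z : int, b = z%:~R) -> x != 0 ->
  rpow_defined x b.
Proof.
move=> [x0|[z ->]]; first by constructor.
rewrite neq_lt => /orP[x0|x0]; last by constructor 1.
by constructor 3; rewrite intr_int.
Qed.

(** All exponents occurring in the Bernoulli equation, namely [1], [- beta] and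
    [1 - beta], are integral combinations of [1] and [beta], and integers are
    closed under these. *)
Lemma rpow_defined_lincomb x b (k l : int) : x != 0 -> rpow_defined x b ->
  rpow_defined x (k%:~R + l%:~R * b).
Proof.
move=> x0 /(rpow_definedP x0) h; apply: rpow_definedI => //.
case: h => [|[z ->]]; first by left.
by right; exists (k + l * z); rewrite rmorphD rmorphM.
Qed.

Lemma rpowD x b c : x != 0 -> rpow_defined x b -> rpow_defined x c ->
  rpow x (b + c) = rpow x b * rpow x c.
Proof.
move=> x0 /(rpow_definedP x0) hb /(rpow_definedP x0) hc.
have [xp|xn] := boolP (0 < x).
  by rewrite !rpow_pos// powRD// x0 implybT.
case: hb hc => [|[z ->]]; first by rewrite (negbTE xn).
case => [|[z' ->]]; first by rewrite (negbTE xn).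
by rewrite -intrD !rpow_intr expfzDr.
Qed.

Lemma rpowr0 x : rpow x 0 = 1.
Proof. exact: (rpow_intr x 0). Qed.

Lemma rpowr1 x : rpow x 1 = x.
Proof. exact: (rpow_intr x 1). Qed.

Lemma rpowrN1 x : rpow x (-1) = x^-1.
Proof. exact: (rpow_intr x (-1)). Qed.

Lemma rpow_neq0 x b : x != 0 -> rpow x b != 0.
Proof.
move=> x0; rewrite /rpow; case: ifPn => _; first exact: expfz_neq0.
by rewrite powR_eq0 (negbTE x0).
Qed.

Lemma rpow0 b : b != 0 -> rpow 0 b = 0.
Proof.
move=> b0; rewrite /rpow; case: ifPn => [/floorK h|_]; last exact: powR0.
rewrite exp0rz; case: eqP => // fb; move: b0.
by rewrite -h fb eqxx.
Qed.

Lemma is_derive_exprn x (n : nat) :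
  is_derive x 1 (fun y : R => y ^+ n) (n%:R * x ^+ n.-1).
Proof.
rewrite (_ : (fun y : R => y ^+ n) = id ^+ n); last first.
  by apply/funext => y; rewrite exprfctE.
have := @is_deriveX _ _ id n x 1 1 (is_derive_id x 1).
by rewrite [_ *: _]mulr1.
Qed.

Lemma is_derive_exprz x (z : int) : x != 0 ->
  is_derive x 1 (fun y : R => y ^ z) (z%:~R * x ^ (z - 1)).
Proof.
move=> x0; case: z => n.
  have := is_derive_exprn x n.
  case: n => [|n]; first by rewrite !mul0r.
  by rewrite -[in Posz _ - 1]addn1 PoszD addrK.
have xn : x ^+ n.+1 != 0 by rewrite expf_neq0.
have := @is_deriveV R (fun y => y ^+ n.+1) x _ 1 xn (is_derive_exprn x n.+1).
congr (is_derive _ _ _ _).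
have -> : Negz n - 1 = Negz n.+1 by rewrite !NegzE -opprD -PoszD addn1.
rewrite NegzE mulrNz [x ^ _]/= [_ *: _]mulNr mulNr; congr (- _).
rewrite -pmulrn (_ : x ^ Negz n.+1 = (x ^+ n.+2)^-1)//.
rewrite !exprS [n.+1.-1]/= expr0; field.
by rewrite x0 expf_neq0.
Qed.

Lemma is_derive_rpow x b : x != 0 -> rpow_defined x b ->
  is_derive x 1 (fun y => rpow y b) (b * rpow x (b - 1)).
Proof.
move=> x0 /(rpow_definedP x0)[xp|[z ->]]; last first.
  rewrite -(intrB _ _ 1) rpow_intr (_ : (fun y => _) = (fun y => y ^ z)).
    exact: is_derive_exprz.
  by apply/funext => y; rewrite rpow_intr.
rewrite rpow_pos//; apply: near_eq_is_derive (is_derive1_powR b xp).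
near=> y; rewrite rpow_pos//; near: y; exact: lt_nbhsr.
Unshelve. all: by end_near. Qed.

(** If [b] and its inverse are both nonzero integers, both have absolute value
    at least one. *)
Lemma rpow_invertible_cases x b : b != 0 -> rpow_invertible x b ->
  [\/ 0 < x, x < 0 /\ b = 1 | x < 0 /\ b = -1].
Proof.
move=> b0 [x0 /(rpow_definedP x0) h1 /(rpow_definedP x0) h2].
have [xp|xn] := boolP (0 < x); first by constructor.
have {}xn : x < 0 by rewrite lt_neqAle x0 leNgt.
case: h1 => [h|[z bz]]; first by have := lt_trans h xn; rewrite ltxx.
case: h2 => [h|[z' bz']]; first by have := lt_trans h xn; rewrite ltxx.
have b1 : 1 <= `|b| by rewrite norm_intr_ge1// bz intr_int.
have : 1 <= `|b^-1| by rewrite norm_intr_ge1 ?invr_eq0// bz' intr_int.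
rewrite normfV invf_ge1 ?normr_gt0// => b2.
have /eqP : `|b| = 1 by apply/le_anti; rewrite b1 b2.
by rewrite eqr_norml => /andP[/orP[/eqP|/eqP] ? _];
  [constructor 2|constructor 3].
Qed.

Lemma rpowK x b : b != 0 -> rpow_invertible x b -> rpow (rpow x b) b^-1 = x.
Proof.
move=> b0 /(rpow_invertible_cases b0)[xp|[xn ->]|[xn ->]].
- by rewrite !rpow_pos ?powR_gt0// -powRrM divff// powRr1// ltW.
- by rewrite invr1 !rpowr1.
- by rewrite invrN invr1 !rpowrN1 invrK.
Qed.

Lemma rpow_invertible_rpow x b : b != 0 ->
  rpow_invertible x b -> rpow_invertible (rpow x b) b.
Proof.
move=> b0 /[dup] -[x0 d1 d2] /(rpow_invertible_cases b0)[xp|[xn bE]|[xn bE]].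
- have h : 0 < rpow x b by rewrite rpow_pos// powR_gt0.
  by split; [rewrite gt_eqF|constructor 1|constructor 1].
- by rewrite bE rpowr1 -bE.
- rewrite bE rpowrN1; split; first by rewrite invr_eq0.
    by constructor 3; rewrite invr_lt0 (intr_int _ (-1)).
  by constructor 3; rewrite invr_lt0 invrN invr1 (intr_int _ (-1)).
Qed.

Lemma rpow_invertible_inv x b : rpow_invertible x b -> rpow_invertible x b^-1.
Proof. by move=> [? ? ?]; split; rewrite ?invrK. Qed.

End RealPower.

(** * Calculus of derivatives along the curve *)

Section Derivative.
Variables (R : realType) (n : nat) (F : set 'rV[R]_n) (J : 'rV[R]_n -> R).
Hypothesis J_inj : set_inj F J.
Hypothesis J_cont : Fcontinuous F J.
Hypothesis F_proper : forall t, F t -> ProperFilter (within F t^').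
Implicit Types (f g : 'rV[R]_n -> R) (t : 'rV[R]_n) (k l : R).


Lemma Fnear_neq t : F t -> \forall t' \near within F t^', J t' - J t != 0.
Proof.
move=> Ft; suff : \forall t' \near t, t' != t -> F t' -> J t' - J t != 0 by [].
apply: (@nearW _ (nbhs t)) => t' tt' Ft'; rewrite subr_eq0.
apply: contra_neq tt' => JJ; exact: J_inj (mem_set Ft') (mem_set Ft) JJ.
Qed.

Lemma Flim_eq f g t l : (forall t', F t' -> f t' = g t') ->
  Flim F f t l -> Flim F g t l.
Proof.
move=> fg h e e0; have [d d0 hd] := h e e0; exists d => // t' Ft' tt'.
by rewrite -fg//; exact: hd.
Qed.

Lemma is_Fderiv_eq f g t l : F t -> (forall t', F t' -> f t' = g t') ->
  is_Fderiv F J f t l -> is_Fderiv F J g t l.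
Proof. by move=> Ft fg; apply: Flim_eq => t' Ft'; rewrite !fg. Qed.

Lemma is_Fderiv_unique f t l l' : F t ->
  is_Fderiv F J f t l -> is_Fderiv F J f t l' -> l = l'.
Proof.
move=> Ft /Flim_cvg h /Flim_cvg h'; have PF := F_proper Ft.
exact: (cvg_unique _ h h').
Qed.

(** This is where continuity of [J] is essential: the increment of [f] is the
    difference quotient times the increment of [J]. *)
Lemma is_Fderiv_continuous f t l : F t ->
  is_Fderiv F J f t l -> f @ within F t^' --> f t.
Proof.
move=> Ft /Flim_cvg h; have /Flim_cvg hJ := J_cont Ft.
have H : (fun t' => (f t' - f t) / (J t' - J t) * (J t' - J t) + f t)
    @ within F t^' --> l * (J t - J t) + f t.
  apply: cvgD; last exact: cvg_cst.
  by apply: cvgM => //; apply: cvgB => //; exact: cvg_cst.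
rewrite subrr mulr0 add0r in H; apply: cvg_trans H.
apply: near_eq_cvg; apply: filterS (Fnear_neq Ft) => t' nz.
by rewrite divfK// subrK.
Qed.

Lemma is_Fderiv_cst k t : is_Fderiv F J (fun=> k) t 0.
Proof.
apply/Flim_cvg; rewrite (_ : (fun=> _) = fun=> 0); first exact: cvg_cst.
by apply/funext => t'; rewrite subrr mul0r.
Qed.

Lemma is_FderivD f g t l l' : is_Fderiv F J f t l -> is_Fderiv F J g t l' ->
  is_Fderiv F J (fun t' => f t' + g t') t (l + l').
Proof.
move=> /Flim_cvg h /Flim_cvg h'; apply/Flim_cvg.
rewrite (_ : (fun t' => _) = (fun t' => (f t' - f t) / (J t' - J t) +
  (g t' - g t) / (J t' - J t))); first exact: cvgD.
by apply/funext => t'; rewrite opprD addrACA mulrDl.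
Qed.

Lemma is_FderivM f g t l l' : F t ->
  is_Fderiv F J f t l -> is_Fderiv F J g t l' ->
  is_Fderiv F J (fun t' => f t' * g t') t (l * g t + f t * l').
Proof.
move=> Ft /Flim_cvg h h'; have gc := is_Fderiv_continuous Ft h'.
move: h' => /Flim_cvg h'; apply/Flim_cvg.
rewrite (_ : (fun t' => _) = (fun t' => (f t' - f t) / (J t' - J t) * g t' +
  f t * ((g t' - g t) / (J t' - J t)))).
  by apply: cvgD; apply: cvgM => //; exact: cvg_cst.
by apply/funext => t'; ring.
Qed.

Lemma is_FderivZ f t k l : F t -> is_Fderiv F J f t l ->
  is_Fderiv F J (fun t' => k * f t') t (k * l).
Proof.
move=> Ft h; have := is_FderivM Ft (is_Fderiv_cst k t) h.
by rewrite mul0r add0r.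
Qed.

(** Caratheodory's form of differentiability of [phi] avoids dividing by an
    increment of [f], which may vanish arbitrarily close to [t]. *)
Lemma is_Fderiv_comp (phi : R -> R) f t k l : F t ->
  is_derive (f t) 1 phi k -> is_Fderiv F J f t l ->
  is_Fderiv F J (phi \o f) t (k * l).
Proof.
move=> Ft /is_derive1_caratheodory[psi [hphi cpsi <-]] h.
have fc := is_Fderiv_continuous Ft h; move: h => /Flim_cvg h; apply/Flim_cvg.
rewrite (_ : (fun t' => _) =
  (fun t' => psi (f t') * ((f t' - f t) / (J t' - J t)))).
  by apply: cvgM => //; apply: cvg_comp fc _; exact: cpsi.
by apply/funext => t'; rewrite /= hphi mulrA.
Qed.

End Derivative.

(** * Linear and Bernoulli equations *)

Section Equations.
Variables (R : realType) (n : nat) (F : set 'rV[R]_n) (J : 'rV[R]_n -> R).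
Hypothesis J_inj : set_inj F J.
Hypothesis J_cont : Fcontinuous F J.
Hypothesis F_proper : forall t, F t -> ProperFilter (within F t^').
Hypothesis primitive0_cst : forall f : 'rV[R]_n -> R,
  Fprimitive F J (fun=> 0) f -> exists c, forall t, F t -> f t = c.
Implicit Types (p g q r y z P M : 'rV[R]_n -> R) (t : 'rV[R]_n) (b beta : R).

Lemma is_Fderiv_rpow y b t l : F t -> y t != 0 -> rpow_defined (y t) b ->
  is_Fderiv F J y t l ->
  is_Fderiv F J (fun t' => rpow (y t') b) t (b * rpow (y t) (b - 1) * l).
Proof.
move=> Ft y0 yb; have hphi := is_derive_rpow y0 yb.
exact: (is_Fderiv_comp J_inj J_cont Ft hphi).
Qed.

Lemma is_Fderiv_expR f t l : F t -> is_Fderiv F J f t l ->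
  is_Fderiv F J (fun t' => expR (f t')) t (expR (f t) * l).
Proof.
move=> Ft; exact: (is_Fderiv_comp J_inj J_cont Ft (is_derive_expR (f t))).
Qed.

Lemma linear_solution_eq p g y z : (forall t, F t -> y t = z t) ->
  linear_solution F J p g y -> linear_solution F J p g z.
Proof.
move=> yz hy t Ft; have [l hl e] := hy t Ft.
by exists l; [exact: is_Fderiv_eq hl|rewrite -yz].
Qed.

(** The derivative of [z * expR P] is [(D z + p z) * expR P], so [z] is a
    solution exactly when [z * expR P - M] is constant. *)
Lemma linear_solutionP p g P M z : Fprimitive F J p P ->
  Fprimitive F J (fun t => g t * expR (P t)) M ->
  linear_solution F J p g z <->
  exists c : R, forall t, F t -> z t = (M t + c) / expR (P t).
Proof.
move=> hP hM; split=> [hz|[c hz]].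
  have [|c hc] := primitive0_cst (f := fun t => z t * expR (P t) + (-1) * M t).
    move=> t Ft; have [l hl e] := hz t Ft.
    have := is_FderivD
      (is_FderivM J_inj J_cont Ft hl (is_Fderiv_expR Ft (hP t Ft)))
      (is_FderivZ J_inj J_cont (-1) Ft (hM t Ft)).
    by congr (is_Fderiv _ _ _ _); rewrite -e; ring.
  exists c => t Ft; rewrite -(hc t Ft) mulN1r addrC subrK mulfK//.
  by rewrite gt_eqF// expR_gt0.
apply: (@linear_solution_eq _ _ (fun t => (M t + c) * expR (- 1 * P t))).
  by move=> t Ft; rewrite hz// mulN1r expRN.
move=> t Ft; exists (g t * expR (P t) * expR (-1 * P t) +
    (M t + c) * (expR (- 1 * P t) * (-1 * p t))).
  apply: is_FderivM => //; last first.
    by apply: is_Fderiv_expR => //; apply: is_FderivZ => //; exact: hP.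
  by have := is_FderivD (hM t Ft) (is_Fderiv_cst F J c t); rewrite addr0.
by rewrite mulN1r expRN mulfK ?gt_eqF ?expR_gt0//; ring.
Qed.

Lemma is_Fderiv_bernoulli y beta t l : F t -> y t != 0 ->
  rpow_defined (y t) beta -> is_Fderiv F J y t l ->
  is_Fderiv F J (fun t' => rpow (y t') (1 - beta)) t
    ((1 - beta) * rpow (y t) (- beta) * l).
Proof.
move=> Ft y0 yb hl.
have := @is_Fderiv_rpow y (1 - beta) t l Ft y0.
rewrite (_ : 1 - beta - 1 = - beta); last by ring.
apply => //.
have := rpow_defined_lincomb 1 (-1) y0 yb.
by rewrite mulN1r.
Qed.

(** The linear equation for [y ^ (1 - beta)] is the Bernoulli equation
    multiplied by [(1 - beta) * y ^ (- beta)]; uniqueness of derivatives allows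
    dividing by this nonzero factor. *)
Lemma bernoulli_linear q r y beta : beta != 1 ->
  (forall t, F t -> y t != 0 /\ rpow_defined (y t) beta) ->
  Fderivable F J y ->
  bernoulli_solution F J q r beta y <->
  linear_solution F J (fun t => (1 - beta) * q t)
    (fun t => (1 - beta) * r t) (fun t => rpow (y t) (1 - beta)).
Proof.
move=> b1 hy dy; have b1' : 1 - beta != 0 by rewrite subr_eq0 eq_sym.
have ident t l : F t ->
    (1 - beta) * rpow (y t) (- beta) * l +
      (1 - beta) * q t * rpow (y t) (1 - beta)
    - (1 - beta) * r t
    = (1 - beta) * rpow (y t) (- beta) *
      (l + q t * y t - r t * rpow (y t) beta).
  move=> Ft; have [y0 yb] := hy t Ft.
  have yN : rpow_defined (y t) (- beta).
    by have := rpow_defined_lincomb 0 (-1) y0 yb; rewrite add0r mulN1r.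
  have y1 : rpow_defined (y t) 1.
    by have := rpow_defined_lincomb 1 0 y0 yb; rewrite mul0r addr0.
  have e1 : rpow (y t) (1 - beta) = y t * rpow (y t) (- beta).
    by rewrite rpowD// rpowr1.
  have e2 : rpow (y t) (- beta) * rpow (y t) beta = 1.
    by rewrite -rpowD// addNr rpowr0.
  have e3 : (1 - beta) * r t =
      (1 - beta) * r t * (rpow (y t) (- beta) * rpow (y t) beta).
    by rewrite e2 mulr1.
  by rewrite e1 e3; ring.
split=> h t Ft; have [y0 yb] := hy t Ft.
  have [_ [l hl e]] := h t Ft; exists ((1 - beta) * rpow (y t) (- beta) * l).
    exact: is_Fderiv_bernoulli.
  by apply/eqP; rewrite -subr_eq0 ident// e subrr mulr0.
split=> //; have [l hl] := dy t Ft; exists l => //.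
have [l' hl' e] := h t Ft.
have ll' := is_Fderiv_unique F_proper Ft (is_Fderiv_bernoulli Ft y0 yb hl) hl'.
move/eqP: e; rewrite -ll' -subr_eq0 ident// mulf_eq0 subr_eq0.
by rewrite mulf_eq0 (negbTE b1') (negbTE (rpow_neq0 _ y0)) /= => /eqP.
Qed.

Lemma rpow_invertible_defined (x beta : R) :
  rpow_invertible x (1 - beta) -> x != 0 /\ rpow_defined x beta.
Proof.
move=> [x0 xb _]; split=> //.
have := rpow_defined_lincomb 1 (-1) x0 xb.
by rewrite mulN1r opprB addrC subrK.
Qed.

(** [Z c] enumerates the solutions of the linear equation.  Where the powers
    [1 - beta] and [(1 - beta)^-1] are inverse to each other, passing from [y]
    to [y ^ (1 - beta)] is reversible, differentiability included. *)
Lemma bernoulli_solutionP q r y beta (Z : R -> 'rV[R]_n -> R) : beta != 1 ->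
  (forall z, linear_solution F J (fun t => (1 - beta) * q t)
     (fun t => (1 - beta) * r t) z <->
     exists c : R, forall t, F t -> z t = Z c t) ->
  (forall t, F t -> rpow_invertible (y t) (1 - beta)) ->
  bernoulli_solution F J q r beta y <->
  exists c : R, forall t, F t -> rpow_invertible (Z c t) (1 - beta) /\
    y t = rpow (Z c t) (1 - beta)^-1.
Proof.
move=> b1 hZ hy; have b1' : 1 - beta != 0 by rewrite subr_eq0 eq_sym.
have hy' t Ft := rpow_invertible_defined (hy t Ft).
split=> [h|[c hc]].
  have dy : Fderivable F J y.
    by move=> t Ft; have [_ [l hl _]] := h t Ft; exists l.
  have /hZ[c hc] := (bernoulli_linear q r b1 hy' dy).1 h.
  exists c => t Ft; rewrite -hc// rpowK//; last exact: hy.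
  by split => //; apply: rpow_invertible_rpow => //; exact: hy.
have lZ : linear_solution F J (fun t => (1 - beta) * q t)
     (fun t => (1 - beta) * r t) (Z c) by apply/hZ; exists c.
have dy : Fderivable F J y.
  move=> t Ft; have [l hl _] := lZ t Ft; have [[Z0 _ Zb] _] := hc t Ft.
  exists ((1 - beta)^-1 * rpow (Z c t) ((1 - beta)^-1 - 1) * l).
  apply: is_Fderiv_eq (is_Fderiv_rpow Ft Z0 Zb hl) => // t' Ft'.
  by have [_ ->] := hc t' Ft'.
apply/(bernoulli_linear q r b1 hy' dy).
apply: linear_solution_eq lZ => t Ft; have [Zi ->] := hc t Ft.
have b1V : (1 - beta)^-1 != 0 by rewrite invr_eq0.
by have := rpowK b1V (rpow_invertible_inv Zi); rewrite invrK.
Qed.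

End Equations.

Theorem mainTheorem3 (R : realType) (n : nat) (alpha : R)
    (halpha : 1 <= alpha <= n%:R)
    (a0 b0 : R) (w : R -> 'rV[R]_n) (F : set 'rV[R]_n)
    (hF : fractal_curve a0 b0 w F)
    (p0 : R) (hp0 : p0 \in `[a0, b0])
    (hfin : (mass alpha w a0 b0 < +oo)%E)
    (hinj : set_inj F (massJ alpha a0 b0 w p0))
    (q r : 'rV[R]_n -> R)
    (hq : Fcontinuous F q) (hr : Fcontinuous F r) (beta : R) :
  let J := massJ alpha a0 b0 w p0 in
  [/\ (* (i) *)
      (beta = 0 -> forall y : 'rV[R]_n -> R,
         (forall theta, F theta -> rpow (y theta) beta = 1) /\
         (bernoulli_solution F J q r beta y <-> linear_solution F J q r y)) /\
      (beta = 1 -> forall y : 'rV[R]_n -> R,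
         bernoulli_solution F J q r beta y <->
         linear_solution F J (fun theta => q theta - r theta) (fun=> 0) y),
      (* (ii) *)
      0 < beta -> bernoulli_solution F J q r beta (fun=> 0)
    & (* (iii) *)
      beta != 0 -> beta != 1 ->
      [/\ (* chain rule for z = y ^ (1 - beta) *)
          (forall y : 'rV[R]_n -> R,
             (forall theta, F theta ->
                y theta != 0 /\ rpow_defined (y theta) beta) ->
             forall theta l, F theta -> is_Fderiv F J y theta l ->
               is_Fderiv F J (fun t => rpow (y t) (1 - beta)) theta
                 ((1 - beta) * rpow (y theta) (- beta) * l)),
          (* reduction to the linear equation *)
          (forall y : 'rV[R]_n -> R,
             (forall theta, F theta ->
                y theta != 0 /\ rpow_defined (y theta) beta) ->
             Fderivable F J y ->
             bernoulli_solution F J q r beta y <->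
             linear_solution F J (fun t => (1 - beta) * q t)
               (fun t => (1 - beta) * r t) (fun t => rpow (y t) (1 - beta)))
        & (* integrating factor and explicit solution; M is the indefinite
             integral of r mu *)
          forall Lambda M : 'rV[R]_n -> R,
            let mu t := expR ((1 - beta) * Lambda t) in
            let Z c t := ((1 - beta) * M t + c) / mu t in
            Fprimitive F J q Lambda ->
            Fprimitive F J (fun t => r t * mu t) M ->
            (forall z : 'rV[R]_n -> R,
               linear_solution F J (fun t => (1 - beta) * q t)
                 (fun t => (1 - beta) * r t) z <->
               exists c : R, forall theta, F theta -> z theta = Z c theta) /\
            (forall y : 'rV[R]_n -> R,
               (forall theta, F theta ->
                  rpow_invertible (y theta) (1 - beta)) ->
               bernoulli_solution F J q r beta y <->
               exists c : R, forall theta, F theta ->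
                 rpow_invertible (Z c theta) (1 - beta) /\
                 y theta = rpow (Z c theta) (1 - beta)^-1)]].
Proof.
move=> J; have /andP[alpha1 _] := halpha.
have Jc : Fcontinuous F J := massJ_Fcontinuous alpha1 hF hp0 hfin.
have Fp : forall t, F t -> ProperFilter (within F t^') := curve_proper hF.
have cst f : Fprimitive F J (fun=> 0) f -> exists c, forall t, F t -> f t = c.
  exact: (Fprimitive0_cst alpha1 hF hp0 hfin hinj (f := f)).
have Ji : set_inj F J := hinj.
clearbody J; clear hfin hp0 hF halpha alpha1 hinj.
(* In the linear cases the exponent is 0 or 1 and y may vanish. *)
have int_defined (x : R) (m : int) : 0 <= m -> rpow_defined x m%:~R.
  move=> m0; have [->|x0] := eqVneq x 0; first by constructor 2; rewrite ler0z.
  by apply: rpow_definedI => //; right; exists m.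
split.
- split=> [-> y|-> y].
    split=> [t _|]; first exact: rpowr0.
    split=> h t Ft; first by have [_ [l hl e]] := h t Ft; exists l => //;
      rewrite e rpowr0 mulr1.
    have [l hl e] := h t Ft; split; first exact: (int_defined _ 0).
    by exists l => //; rewrite e rpowr0 mulr1.
  split=> h t Ft.
    have [_ [l hl e]] := h t Ft; exists l => //.
    by rewrite rpowr1 in e; rewrite mulrBl addrA e subrr.
  have [l hl e] := h t Ft; split; first exact: (int_defined _ 1).
  by exists l => //; apply/eqP; rewrite rpowr1 -subr_eq0 -addrA -mulrBl e.
- move=> b0' t Ft; split; first by constructor 2; rewrite ltW.
  exists 0; first exact: is_Fderiv_cst.
  by rewrite rpow0 ?gt_eqF// !mulr0 addr0.
- move=> _ b1; split.
  + by move=> y hy t l Ft hl; have [? ?] := hy t Ft; exact: is_Fderiv_bernoulli.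
  + by move=> y hy dy; exact: bernoulli_linear.
  + move=> Lambda M mu Z hL hM.
    have hP : Fprimitive F J (fun t => (1 - beta) * q t)
        (fun t => (1 - beta) * Lambda t).
      by move=> t Ft; apply: is_FderivZ => //; exact: hL.
    have hM' : Fprimitive F J (fun t => (1 - beta) * r t * mu t)
        (fun t => (1 - beta) * M t).
      by move=> t Ft; rewrite -mulrA; apply: is_FderivZ => //; exact: hM.
    have hZ := linear_solutionP Ji Jc cst _ hP hM'.
    by split=> // y hy; exact: bernoulli_solutionP.
Qed.
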